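(* Let $n\ge1$ and $\alpha>-1$. Every radial Toeplitz operator on $\mathcal{H}^2_\alpha(\mathbb{B}^n)$ is a symmetric separately radial Toeplitz operator; that is, if $a\in L^\infty(\mathbb{B}^n)$ is radial, then $T_a$ is a Toeplitz operator with symmetric separately radial symbol.
   Context: $\mathbb{B}^n=\{z\in\mathbb{C}^n:|z|<1\}$ is the open unit ball. For $\alpha>-1$, $dv_\alpha(z)=c_\alpha(1-|z|^2)^\alpha\,dv(z)$, where $dv$ is Lebesgue measure and $c_\alpha$ is the constant making $v_\alpha(\mathbb{B}^n)=1$. $\mathcal{H}^2_\alpha(\mathbb{B}^n)$ is the weighted Bergman space of holomorphic functions in $L^2(\mathbb{B}^n,v_\alpha)$. For $a\in L^\infty(\mathbb{B}^n)$ the Toeplitz operator $T_a$ on $\mathcal{H}^2_\alpha(\mathbb{B}^n)$ with symbol $a$ is $T_a(f)(z)=\int_{\mathbb{B}^n}a(w)f(w)(1-z\cdot\overline{w})^{-(n+\alpha+1)}\,dv_\alpha(w)$. A function $a\in L^\infty(\mathbb{B}^n)$ is radial if it is $U(n)$-invariant, i.e. $a(z)=a(|z|)$ depends only on $|z|$ (almost everywhere); a radial Toeplitz operator is $T_a$ with $a$ radial. A function $a\in L^\infty(\mathbb{B}^n)$ is symmetric separately radial if $a(z)=a(|z_1|,\dots,|z_n|)$ and $a(\sigma(z))=a(z)$ for every $\sigma\in S_n$ (the symmetric group), for almost every $z\in\mathbb{B}^n$, where $\sigma(z)=(z_{\sigma(1)},\dots,z_{\sigma(n)})$; a symmetric separately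 radial Toeplitz operator is $T_a$ with such $a$. *)

(* Defs.v *)
From HB Require Import structures.
From mathcomp Require Import all_boot all_order all_algebra perm.
From mathcomp Require Import complex spectral.
From mathcomp Require Import all_classical all_reals all_analysis.
From mathcomp Require Import measurable_realfun ess_sup_inf.

Set Implicit Arguments.
Unset Strict Implicit.
Unset Printing Implicit Defensive.

Import Order.TTheory GRing.Theory Num.Theory.
Import ComplexField.Normc numFieldNormedType.Exports.

Local Open Scope classical_set_scope.
Local Open Scope ring_scope.

HB.instance Definition _ (R : realType) := Pointed.copy R[i] R[i]^o.

(* R[i] carries the sigma-algebra generated by the real and imaginary parts,
   and 'rV[T]_n the one generated by the coordinates; on 'rV[R[i]]_n this is
   the Borel sigma-algebra of C^n. *)
Definition complex_display : measure_display.
Proof. exact: default_measure_display. Qed.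

Section measurable_complex.
Context (R : realType).

Definition complex_measurable : set (set R[i]) :=
  g_sigma_preimageU (@complex.Re R : _ -> measurableTypeR R)
                    (@complex.Im R : _ -> measurableTypeR R).

Let complex_measurable0 : complex_measurable set0.
Proof. exact: sigma_algebra0. Qed.

Let complex_measurableC A : complex_measurable A -> complex_measurable (~` A).
Proof. exact: sigma_algebraC. Qed.

Let complex_measurable_bigcup (F : (set R[i])^nat) :
  (forall k, complex_measurable (F k)) ->
  complex_measurable (\bigcup_k F k).
Proof. exact: sigma_algebra_bigcup. Qed.

HB.instance Definition _ := @isMeasurable.Build complex_display R[i]
  complex_measurable complex_measurable0 complex_measurableC
  complex_measurable_bigcup.

Lemma measurable_Re : measurable_fun [set: R[i]]
  (@complex.Re R : _ -> measurableTypeR R).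
Proof. by move=> _ A mA; apply: sub_sigma_algebra; left; exists A. Qed.

Lemma measurable_Im : measurable_fun [set: R[i]]
  (@complex.Im R : _ -> measurableTypeR R).
Proof. by move=> _ A mA; apply: sub_sigma_algebra; right; exists A. Qed.

Lemma measurable_fun_complex d (T : measurableType d) (f : T -> R[i]) :
  measurable_fun setT (fun x => complex.Re (f x) : measurableTypeR R) ->
  measurable_fun setT (fun x => complex.Im (f x) : measurableTypeR R) ->
  measurable_fun setT f.
Proof.
move=> mRe mIm; apply: measurability; first exact: erefl.
move=> _ [_ [[B mB <-]|[B mB <-]] <-]; rewrite setTI.
  exact: mRe.
exact: mIm.
Qed.

End measurable_complex.

Definition row_display (d : measure_display) : measure_display.
Proof. exact. Qed.

Section measurable_row.
Context d (T : measurableType d) (n : nat).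

Definition row_measurable : set (set 'rV[T]_n) :=
  g_sigma_preimage (fun (i : 'I_n) (v : 'rV[T]_n) => v ord0 i).

Let row_measurable0 : row_measurable set0.
Proof. exact: sigma_algebra0. Qed.

Let row_measurableC A : row_measurable A -> row_measurable (~` A).
Proof. exact: sigma_algebraC. Qed.

Let row_measurable_bigcup (F : (set 'rV[T]_n)^nat) :
  (forall k, row_measurable (F k)) -> row_measurable (\bigcup_k F k).
Proof. exact: sigma_algebra_bigcup. Qed.

HB.instance Definition _ := @isMeasurable.Build (row_display d) 'rV[T]_n
  row_measurable row_measurable0 row_measurableC row_measurable_bigcup.

Lemma measurable_coord (i : 'I_n) :
  measurable_fun [set: 'rV[T]_n] (fun v => v ord0 i).
Proof.
move=> _ A mA; rewrite setTI; apply: sub_sigma_algebra => /=.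
rewrite -bigcup_seq/=; exists i => /=; first by rewrite mem_index_enum.
by exists A => //; rewrite setTI.
Qed.

Lemma measurable_fun_row d' (S : measurableType d') (f : S -> 'rV[T]_n) :
  (forall i, measurable_fun setT (fun x => f x ord0 i)) ->
  measurable_fun setT f.
Proof.
move=> mf; apply: measurability; first exact: erefl.
move=> _ [B + <-].
rewrite -bigcup_seq => -[i _ [A mA <-]].
by rewrite setTI; exact: mf.
Qed.

End measurable_row.

(* The product of two sigma-finite measures, transported along a measurable
   bijection f : T1 * T2 -> T3 with measurable inverse g. *)
Section product_transport.
Context d1 d2 d3 (T1 : measurableType d1) (T2 : measurableType d2)
  (T3 : measurableType d3) (R : realType).
Variables (f : T1 * T2 -> T3) (g : T3 -> T1 * T2).
Variable mu1 : {sigma_finite_measure set T1 -> \bar R}.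
Variable mu2 : {sigma_finite_measure set T2 -> \bar R}.

Definition product_transport of cancel f g & measurable_fun setT f &
  measurable_fun setT g := pushforward (mu1 \x mu2)%E f.

Hypotheses (fK : cancel f g).
Hypotheses (mf : measurable_fun setT f) (mg : measurable_fun setT g).

Local Notation pmu := (product_transport fK mf mg).

HB.instance Definition _ := Measure.copy pmu
  (measure_function_pushforward__canonical__measure_function_Measure
     (mu1 \x mu2)%E mf).

Let pmu_sigma_finite : sigma_finite setT pmu.
Proof.
have /sigma_finiteP[F [FT ndF Foo]] := sigma_finiteT mu1.
have /sigma_finiteP[G [GT ndG Goo]] := sigma_finiteT mu2.
exists (fun k => g @^-1` (F k `*` G k)).
  rewrite -preimage_bigcup; apply/esym; rewrite -subTset => y _ /=.
  have [i _ Fi] : (\bigcup_k F k) (g y).1 by rewrite -FT.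
  have [j _ Gj] : (\bigcup_k G k) (g y).2 by rewrite -GT.
  exists (maxn i j) => //; split.
  - by move: Fi; exact/subsetPset/ndF/leq_maxl.
  - by move: Gj; exact/subsetPset/ndG/leq_maxr.
move=> k; have [mF Fk] := Foo k; have [mG Gk] := Goo k; split.
  by rewrite -[X in measurable X]setTI; apply: mg => //; exact: measurableX.
rewrite /product_transport /pushforward -comp_preimage.
rewrite (_ : g \o f = id); last exact/funext.
by rewrite preimage_id product_measure1E// lte_mul_pinfty// ge0_fin_numE.
Qed.

HB.instance Definition _ :=
  Measure_isSigmaFinite.Build _ _ _ pmu pmu_sigma_finite.

End product_transport.

Section lebesgue_complex.
Context (R : realType).

Let mR := measurableTypeR R.
Let to_complex (p : mR * mR) : R[i] := Complex p.1 p.2.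
Let of_complex (z : R[i]) : mR * mR := (complex.Re z, complex.Im z).

Let to_complexK : cancel to_complex of_complex. Proof. by case. Qed.

Let measurable_to_complex : measurable_fun setT to_complex.
Proof.
by apply: measurable_fun_complex; [exact: measurable_fst|exact: measurable_snd].
Qed.

Let measurable_of_complex : measurable_fun setT of_complex.
Proof.
by apply: measurable_fun_pair; [exact: measurable_Re|exact: measurable_Im].
Qed.

Definition lebesgue_C : {sigma_finite_measure set R[i] -> \bar R} :=
  product_transport (@lebesgue_measure R) (@lebesgue_measure R)
    to_complexK measurable_to_complex measurable_of_complex.

Section cons.
Variable n : nat.

Let cons_row (p : R[i] * 'rV[R[i]]_n) : 'rV[R[i]]_n.+1 :=
  \row_i (if unlift ord0 i is Some j then p.2 ord0 j else p.1).
Let uncons_row (v : 'rV[R[i]]_n.+1) : R[i] * 'rV[R[i]]_n :=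
  (v ord0 ord0, \row_j v ord0 (lift ord0 j)).

Let cons_rowK : cancel cons_row uncons_row.
Proof.
move=> [x v]; congr pair; first by rewrite mxE unlift_none.
by apply/rowP => j; rewrite !mxE liftK.
Qed.

Let measurable_cons_row : measurable_fun setT cons_row.
Proof.
apply: measurable_fun_row => i; under eq_fun do rewrite mxE.
case: (unlift ord0 i) => [j|]; last exact: measurable_fst.
by apply: (measurableT_comp (measurable_coord j)); exact: measurable_snd.
Qed.

Let measurable_uncons_row : measurable_fun setT uncons_row.
Proof.
apply: measurable_fun_pair; first exact: measurable_coord.
by apply: measurable_fun_row => j; under eq_fun do rewrite mxE;
  exact: measurable_coord.
Qed.

Definition lebesgue_cons (mu : {sigma_finite_measure set 'rV[R[i]]_n -> \bar R}) :
    {sigma_finite_measure set 'rV[R[i]]_n.+1 -> \bar R} :=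
  product_transport lebesgue_C mu
    cons_rowK measurable_cons_row measurable_uncons_row.

End cons.

(* Lebesgue measure dv on C^n, as the n-fold product of lebesgue_C. *)
Fixpoint lebesgue_Cn n : {sigma_finite_measure set 'rV[R[i]]_n -> \bar R} :=
  if n is m.+1 then lebesgue_cons (lebesgue_Cn m) else \d_(0 : 'rV[R[i]]_0).

End lebesgue_complex.

Section unit_ball.
Context (R : realType) (n : nat).
Implicit Types z w : 'rV[R[i]]_n.

Definition cdot z w : R[i] := \sum_i z ord0 i * conjc (w ord0 i).

(* The Euclidean norm; the canonical norm of 'rV is the sup norm. *)
Definition enorm z : R := Num.sqrt (\sum_i normc (z ord0 i) ^+ 2).

Definition unit_ball : set 'rV[R[i]]_n := [set z | enorm z < 1].

Lemma measurable_enorm : measurable_fun setT enorm.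
Proof.
have mf i : measurable_fun [set: 'rV[R[i]]_n]
    (fun z => (normc (z ord0 i) ^+ 2 : R)).
  rewrite (_ : (fun z => _) = fun z : 'rV[R[i]]_n =>
    complex.Re (z ord0 i) ^+ 2 + complex.Im (z ord0 i) ^+ 2).
    apply: measurable_funD; apply: measurable_funX.
    - by apply: (measurableT_comp (@measurable_Re R)); exact: measurable_coord.
    - by apply: (measurableT_comp (@measurable_Im R)); exact: measurable_coord.
  apply/funext => z; case: (z ord0 i) => x y /=.
  by rewrite sqr_sqrtr// addr_ge0// sqr_ge0.
have msqrt : measurable_fun [set: R] (@Num.sqrt R).
  by apply: continuous_measurable_fun; exact: sqrt_continuous.
by apply: (measurableT_comp msqrt); exact: measurable_sum.
Qed.

Lemma measurable_unit_ball : measurable unit_ball.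
Proof.
have -> : unit_ball = setT `&` enorm @^-1` `]-oo, 1[%classic.
  by rewrite setTI; apply/seteqP; split=> z /=; rewrite in_itv.
by apply: measurable_enorm => //; exact: measurable_itv.
Qed.

End unit_ball.

Arguments unit_ball {R} n.

(* The measure dv_alpha = c_alpha (1 - |z|^2)^alpha dv on the unit ball, extended
   by 0 to C^n. *)
Section weighted_measure.
Context (R : realType) (n : nat) (alpha : R).
Local Notation B := (@unit_ball R n).
Local Notation leb := (@lebesgue_Cn R n).

Definition weight (z : 'rV[R[i]]_n) : R := (1 - enorm z ^+ 2) `^ alpha.

Definition norm_const : R := (fine (\int[leb]_(z in B) (weight z)%:E)%E)^-1.

Definition vol_alpha (A : set 'rV[R[i]]_n) : \bar R :=
  (norm_const%:E * \int[leb]_(z in A `&` B) (weight z)%:E)%E.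

Lemma measurable_weight : measurable_fun setT weight.
Proof.
apply: (@measurableT_comp _ _ _ _ _ _ (@powR R ^~ alpha)) => //.
apply: measurable_funB => //; apply: measurable_funX.
exact: measurable_enorm.
Qed.

Lemma norm_const_ge0 : 0 <= norm_const.
Proof.
rewrite invr_ge0 fine_ge0//; apply: integral_ge0 => z _.
by rewrite lee_fin powR_ge0.
Qed.

Let vol_alpha0 : vol_alpha set0 = 0%E.
Proof. by rewrite /vol_alpha set0I integral_set0 mule0. Qed.

Let vol_alpha_ge0 A : (0 <= vol_alpha A)%E.
Proof.
apply: mule_ge0; first by rewrite lee_fin norm_const_ge0.
by apply: integral_ge0 => z _; rewrite lee_fin powR_ge0.
Qed.

Let vol_alpha_sigma_additive : semi_sigma_additive vol_alpha.
Proof.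
move=> F mF tF mUF; rewrite /vol_alpha setI_bigcupl ge0_integral_bigcup//.
- rewrite -nneseriesZl//.
    apply: is_cvg_ereal_nneg_natsum_cond => k _ _; exact: vol_alpha_ge0.
  by move=> k _; apply: integral_ge0 => z _; rewrite lee_fin powR_ge0.
- by move=> k; apply: measurableI => //; exact: measurable_unit_ball.
- by apply/measurable_EFinP/measurable_funTS; exact: measurable_weight.
- by move=> z _; rewrite lee_fin powR_ge0.
- exact: trivIset_setIr.
Qed.

HB.instance Definition _ := isMeasure.Build _ _ _ vol_alpha
  vol_alpha0 vol_alpha_ge0 vol_alpha_sigma_additive.

End weighted_measure.

(* Principal argument, in ]-pi, pi], and principal branch of u^s. *)
Definition carg (R : realType) (u : R[i]) : R :=
  let t := acos (complex.Re u / normc u) in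
  if 0 <= complex.Im u then t else - t.

Definition cpow (R : realType) (u : R[i]) (s : R) : R[i] :=
  Complex (normc u `^ s * cos (s * carg u)) (normc u `^ s * sin (s * carg u)).

Definition cintegral d (T : measurableType d) (R : realType)
    (mu : {measure set T -> \bar R}) (D : set T) (g : T -> R[i]) : R[i] :=
  Complex (\int[mu]_(x in D) complex.Re (g x))
          (\int[mu]_(x in D) complex.Im (g x)).

(* For K = R[i], differentiability is complex Frechet differentiability. *)
Definition holomorphic_on (K : numFieldType) (V W : normedModType K)
    (U : set V) (f : V -> W) : Prop :=
  forall z, U z -> differentiable f z.

Section toeplitz.
Context (R : realType) (n : nat) (alpha : R).
Local Notation Cn := 'rV[R[i]]_n.
Local Notation B := (@unit_ball R n).
Local Notation leb := (@lebesgue_Cn R n).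
Local Notation vol := (@vol_alpha R n alpha).

(* Elements of L^oo(B) are given by Borel representatives; their values off B
   play no role. *)
Definition Linfty (a : Cn -> R[i]) : Prop :=
  measurable_fun B a /\
  (ess_sup (mrestr leb (@measurable_unit_ball R n))
     (fun z => (normc (a z))%:E) < +oo)%E.

(* A representative f of an element of the Bergman space is only meaningful
   on B. *)
Definition bergman : set (Cn -> R[i]) := [set f |
  @holomorphic_on R[i] Cn R[i]^o B f /\
  (\int[vol]_(z in B) (normc (f z) ^+ 2)%:E < +oo)%E].

(* On B the base 1 - z . conj w has positive real part, so that its principal
   power is holomorphic in z. *)
Definition toeplitz (a : Cn -> R[i]) (f : bergman) (z : B) : R[i] :=
  cintegral vol B (fun w =>
    a w * set_val f w * cpow (1 - cdot (set_val z) w) (- (n%:R + alpha + 1))).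

Definition radial (a : Cn -> R[i]) : Prop :=
  exists b : R -> R[i], {ae leb, forall z, B z -> a z = b (enorm z)}.

(* col_perm s z is the row (z_(s 0), ..., z_(s (n - 1))). *)
Definition symm_sep_radial (a : Cn -> R[i]) : Prop :=
  exists b : 'rV[R]_n -> R[i],
    {ae leb, forall z, B z ->
       a z = b (map_mx (@normc R) z) /\
       forall s : 'S_n, a (col_perm s z) = a z}.

Definition radial_toeplitz (T : bergman -> B -> R[i]) : Prop :=
  exists a, [/\ Linfty a, radial a & T = toeplitz a].

Definition symm_sep_radial_toeplitz (T : bergman -> B -> R[i]) : Prop :=
  exists a, [/\ Linfty a, symm_sep_radial a & T = toeplitz a].

End toeplitz.

Arguments bergman {R} n alpha.

Section unitary.
Context (R : realType).
Local Open Scope sesquilinear_scope.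

Lemma sqr_enormE n (z : 'rV[R[i]]_n) :
  real_complex R (enorm z ^+ 2) = (z *m z^t*) ord0 ord0.
Proof.
rewrite /enorm sqr_sqrtr ?sumr_ge0// => [|i _]; last exact: sqr_ge0.
rewrite rmorph_sum mxE; apply: eq_bigr => i _.
by rewrite !mxE -normCK rmorphXn/=; congr (_ ^+ 2).
Qed.

Lemma enorm_unitary n (U : 'M[R[i]]_n) (z : 'rV[R[i]]_n) :
  U \is unitarymx -> enorm (z *m U) = enorm z.
Proof.
move=> unitaryU; apply: (pexpIrn (n := 2)) => //; rewrite ?nnegrE ?sqrtr_ge0//.
apply: (@complexI R); rewrite !sqr_enormE trmx_mul map_mxM mulmxA.
by rewrite mulmxtVK.
Qed.

Let unitary_e0 n (z : 'rV[R[i]]_n.+1) : exists2 U : 'M[R[i]]_n.+1,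
  U \is unitarymx & z *m U = real_complex R (enorm z) *: delta_mx ord0 ord0.
Proof.
pose A : 'M[R[i]]_n.+1 := \matrix_(i, j) z ord0 j.
have rA : row ord0 A = z by apply/rowP => j; rewrite !mxE.
pose S := schmidt A.
have uS : S \is unitarymx by exact: schmidt_unitarymx.
have [c zE] : exists c, z = c *: row ord0 S.
  have := row_schmidt_sub A ord0; rewrite rA (bigD1 ord0)//= big1; last first.
    by case=> [[|i] ?].
  by rewrite addsmx0 genmxE => /sub_rVP.
have SS : row ord0 S *m S^t* = delta_mx ord0 ord0.
  by rewrite -row_mul (unitarymxP uS) row1.
have S0 : (row ord0 S *m (row ord0 S)^t*) ord0 ord0 = 1.
  have /matrixP/(_ ord0 ord0) := unitarymxP uS; rewrite !mxE eqxx => S1.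
  rewrite mulr1n in S1; rewrite -[RHS]S1.
  by apply: eq_bigr => i _; rewrite !mxE.
have c_ge0 : 0 <= c.
  have := form1_row_schmidt A ord0; rewrite rA dotmxE {1}zE -scalemxAl mxE.
  by rewrite -/S S0 mulr1.
exists (S^t*); first by rewrite trmxC_unitary.
rewrite {1}zE -scalemxAl SS; congr (_ *: _).
apply: (pexpIrn (n := 2)) => //; rewrite ?nnegrE ?lecR ?sqrtr_ge0//.
rewrite -rmorphXn /= sqr_enormE zE -scalemxAl mxE linearZ/= map_mxZ -scalemxAr.
rewrite mxE S0 mulr1 expr2; congr (_ * _).
exact: esym (CrealP (ger0_real c_ge0)).
Qed.

Lemma unitary_transitive n (z w : 'rV[R[i]]_n) : enorm z = enorm w ->
  exists2 U : 'M[R[i]]_n, U \is unitarymx & z *m U = w.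
Proof.
case: n z w => [|n] z w zw.
  by exists 1%:M; [apply/unitarymxP; rewrite [LHS]flatmx0 [RHS]flatmx0
                  |rewrite [LHS]thinmx0 [RHS]thinmx0].
have [U uU zU] := unitary_e0 z; have [V uV wV] := unitary_e0 w.
exists (U *m V^t*); first by rewrite mul_unitarymx// trmxC_unitary.
by rewrite mulmxA zU zw -wV mulmxtVK.
Qed.

End unitary.

(* Radial symbols are the U(n)-invariant ones, up to a null set. *)
Lemma radialP (R : realType) n (a : 'rV[R[i]]_n -> R[i]) :
  radial a <-> exists2 b : 'rV[R[i]]_n -> R[i],
    (forall U : 'M[R[i]]_n, U \is unitarymx -> forall z, b (z *m U) = b z) &
    {ae (@lebesgue_Cn R n), forall z, unit_ball n z -> a z = b z}.
Proof.
split=> [[b ab]|[b bU ab]].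
  by exists (b \o (@enorm R n)) => //= U uU z; rewrite enorm_unitary.
pose r t := b (xget 0 [set z | enorm z = t]).
suff br z : b z = r (enorm z) by exists r; apply: filterS ab => z az /az ->.
rewrite /r; case: xgetP => [w _ /= wz|/(_ z)/(_ erefl)//].
by have [U uU <-] := unitary_transitive wz; rewrite bU.
Qed.

(* Main.v *)
(* A radial symbol is itself symmetric separately radial. The only point is the
   almost-everywhere clause: permuting coordinates must preserve null sets. It
   even preserves Lebesgue measure on C^n, since a box is sent to a box whose
   measure is the same product with permuted factors, and boxes form a pi-system
   generating the sigma-algebra. *)
Require Import Defs.
From mathcomp Require Import all_boot all_order all_algebra perm.
From mathcomp Require Import complex.
From mathcomp Require Import all_classical all_reals all_analysis.

Set Implicit Arguments.
Unset Strict Implicit.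
Unset Printing Implicit Defensive.

Import Order.TTheory GRing.Theory Num.Theory.

Local Open Scope classical_set_scope.
Local Open Scope ring_scope.

Section box.
Context d (T : measurableType d) (n : nat).

Definition box (A : 'I_n -> set T) : set 'rV[T]_n :=
  [set v | forall i, A i (v ord0 i)].

Definition boxes : set (set 'rV[T]_n) :=
  [set box A | A in [set A | forall i, measurable (A i)]].

Lemma measurable_box A : (forall i, measurable (A i)) -> measurable (box A).
Proof.
move=> mA; rewrite (_ : box A =
    \bigcap_(i in [set: 'I_n]) ((fun v : 'rV[T]_n => v ord0 i) @^-1` A i)).
  apply: fin_bigcap_measurable => // i _.
  by rewrite -[X in measurable X]setTI; exact: measurable_coord.
by apply/seteqP; split=> v /= Av i => [_|]; exact: Av.
Qed.

Lemma setI_closed_boxes : setI_closed boxes.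
Proof.
move=> _ _ [A mA <-] [B mB <-]; exists (fun i => A i `&` B i).
  by move=> i; exact: measurableI.
apply/seteqP; split=> [v AB|v [Av Bv] i /=]; last by split.
by split=> i; case: (AB i).
Qed.

Lemma measurable_boxes :
  [set A : set 'rV[T]_n | measurable A] = <<s boxes >>.
Proof.
apply/seteqP; split; last first.
  apply: smallest_sub; first exact: sigma_algebra_measurable.
  by move=> _ [A mA <-]; exact: measurable_box.
apply: sub_smallest2r; first exact: smallest_sigma_algebra.
move=> B; rewrite -bigcup_seq => -[i _ [A mA <-]]; rewrite setTI.
(* A generating cylinder over the [i]-th coordinate is a box whose other sides are all full. *)
exists (fun j => if j == i then A else setT) => [j /=|]; first by case: ifP.
apply/seteqP; split=> [v /(_ i)|v Av j /=]; first by rewrite eqxx.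
by case: eqP => // ->.
Qed.

Lemma measurable_col_perm (s : 'S_n) :
  measurable_fun [set: 'rV[T]_n] (col_perm s).
Proof.
apply: measurable_fun_row => i; under eq_fun do rewrite mxE.
exact: measurable_coord.
Qed.

(** Entry [i] of [col_perm s v] is entry [s i] of [v], so the side [A i] constrains coordinate
    [s i]; hence the inverse permutation. *)
Lemma preimage_col_perm_box (s : 'S_n) A :
  col_perm s @^-1` box A = box (A \o s^-1%g).
Proof.
apply/seteqP; split=> v Av i /=.
  by have := Av (s^-1%g i); rewrite mxE permKV.
by have := Av (s i); rewrite /= permK mxE.
Qed.

End box.

Section lebesgue_Cn_col_perm.
Context (R : realType).

(** By induction on [n]: prepending a coordinate pulls a box back to the rectangle of its first side
    and the box of the others. For [n = 0] the Dirac mass matches the empty product. *)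
Lemma lebesgue_Cn_box n (A : 'I_n -> set R[i]) :
  (forall i, measurable (A i)) ->
  lebesgue_Cn R n (box A) = (\prod_(i < n) lebesgue_C R (A i))%E.
Proof.
elim: n A => [|n IHn] A mA.
  by rewrite big_ord0/= diracE mem_set// => -[].
rewrite big_ord_recl -IHn; last by move=> i; exact: mA.
rewrite -product_measure1E//; last exact: measurable_box.
rewrite /= /product_transport /pushforward; congr (_ _).
apply/seteqP; split=> [[x v] Av|[x v] [/= Ax Av] i /=].
  split=> [|i] /=; first by have := Av ord0; rewrite mxE unlift_none.
  by have := Av (lift ord0 i); rewrite mxE liftK.
by rewrite mxE; case: unliftP => [j|] ->.
Qed.

Lemma lebesgue_Cn_col_perm n (s : 'S_n) (A : set 'rV[R[i]]_n) :
  measurable A -> lebesgue_Cn R n (col_perm s @^-1` A) = lebesgue_Cn R n A.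
Proof.
(* The cubes with all sides [F k] are the exhaustion by boxes of finite measure that uniqueness of
   measures requires. *)
have /sigma_finiteP[F [FT ndF Foo]] := sigma_finiteT (lebesgue_C R).
have ms := @measurable_col_perm _ R[i] n s.
move=> mA; apply/esym; apply: (measure_unique (@boxes _ R[i] n)
  (fun k => box (fun=> F k)) _ _ _ _ (lebesgue_Cn R n)
  (pushforward (lebesgue_Cn R n) (col_perm s))) => //.
- exact: measurable_boxes.
- exact: setI_closed_boxes.
- by move=> k; exists (fun=> F k) => // i; case: (Foo k).
- rewrite -subTset => v _.
  have /choice[k Fk] : forall i : 'I_n, exists k, F k (v ord0 i).
    move=> i.
    have [k _ Fk] : (\bigcup_k F k) (v ord0 i) by rewrite -FT.
    by exists k.
  (* As [F] is nondecreasing, the largest index serves every coordinate at once. *)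
  exists (\max_i k i)%N => // i.
  by move: (Fk i); exact/subsetPset/ndF/leq_bigmax.
- move=> _ [B mB <-]; rewrite /pushforward.
  rewrite [X in _ = lebesgue_Cn R n X](preimage_col_perm_box s B).
  rewrite [LHS](lebesgue_Cn_box mB) [RHS]lebesgue_Cn_box => [|i];
    last exact: mB.
  rewrite [RHS](reindex_inj (@perm_inj _ s)); apply: eq_bigr => i _.
  by rewrite /comp permK.
- move=> k; rewrite [ltLHS]lebesgue_Cn_box => [|i]; last by case: (Foo k).
  suff /andP[] : (0 <= \prod_(i < n) lebesgue_C R (F k) < +oo)%E by [].
  (* Nonnegativity is carried along because the bound [< +oo] alone is not stable under products in
     the extended reals. *)
  apply: (big_ind (fun x => 0 <= x < +oo)%E) => [|x y /andP[x0 xoo] /andP[y0 yoo]|_ _].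
  + by rewrite lee01 ltry.
  + by rewrite mule_ge0// lte_mul_pinfty// ge0_fin_numE.
  + by rewrite measure_ge0; case: (Foo k).
Qed.

Lemma ae_col_perm n (s : 'S_n) (P : 'rV[R[i]]_n -> Prop) :
  {ae lebesgue_Cn R n, forall z, P z} ->
  {ae lebesgue_Cn R n, forall z, P (col_perm s z)}.
Proof.
move=> [N [mN N0 PN]]; exists (col_perm s @^-1` N); split.
- by rewrite -[X in measurable X]setTI; exact: measurable_col_perm.
- by rewrite lebesgue_Cn_col_perm.
- by move=> z Pz; exact: PN.
Qed.

Lemma enorm_col_perm n (s : 'S_n) (z : 'rV[R[i]]_n) :
  enorm (col_perm s z) = enorm z.
Proof.
rewrite /enorm [in RHS](reindex_inj (@perm_inj _ s))/=; congr Num.sqrt.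
by apply: eq_bigr => i _; rewrite mxE.
Qed.

Lemma radial_symm_sep_radial n (a : 'rV[R[i]]_n -> R[i]) :
  radial a -> symm_sep_radial a.
Proof.
move=> [b ab]; exists (fun r => b (Num.sqrt (\sum_i r ord0 i ^+ 2))).
(* The quantifier over [s] sits inside the almost-everywhere clause: ['S_n] is finite, so one null
   set serves all permutations. *)
have abs : {ae lebesgue_Cn R n, forall z, forall s : 'S_n,
    unit_ball n (col_perm s z) -> a (col_perm s z) = b (enorm (col_perm s z))}.
  by apply: filter_forall => s; exact: ae_col_perm ab.
apply: filterS2 ab abs => z az azs Bz; split=> [|s].
  by rewrite az//; congr (b (Num.sqrt _)); apply: eq_bigr => i _; rewrite mxE.
by rewrite azs /unit_ball/= enorm_col_perm// az.
Qed.

End lebesgue_Cn_col_perm.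

Local Close Scope classical_set_scope.

Theorem mainTheorem6 (R : realType) (n : nat) (alpha : R)
    (n_ge1 : (1 <= n)%N) (alpha_gtN1 : -1 < alpha)
    (T : bergman n alpha -> @unit_ball R n -> R[i]) :
  radial_toeplitz T -> symm_sep_radial_toeplitz T.
Proof.
by move=> [a [aoo ra ->]]; exists a; split=> //; exact: radial_symm_sep_radial.
Qed.
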